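(* Let $k\ge 1$ and let $(\mathbf{W},\mathbf{W}')\in\mathbb{R}^k\times\mathbb{R}^k$ be an exchangeable pair of random vectors satisfying $$E(\mathbf{W}'\mid\mathbf{W})=(I_k-\Lambda)\mathbf{W}$$ for some invertible real $k\times k$ matrix $\Lambda$. Assume that $\|\mathbf{W}-\mathbf{W}'\|_2\le K$ (almost surely) for some constant $K>0$, and that $m(\boldsymbol{\theta})=E(e^{\boldsymbol{\theta}^t\mathbf{W}})<\infty$ for all $\boldsymbol{\theta}\in\mathbb{R}^k$. Let $\sigma_1(\Lambda)$ denote the smallest singular value of $\Lambda$ and put $\nu_1=1/\sigma_1(\Lambda)$. Then for any $\mathbf{w}=(w_1,\dots,w_k)\succeq\mathbf{0}$, $$P(\mathbf{W}\succeq\mathbf{w})\le\exp\left(-\frac{\|\mathbf{w}\|_2^2}{2K^2\nu_1}\right)\quad\text{and}\quad P(\mathbf{W}\preceq-\mathbf{w})\le\exp\left(-\frac{\|\mathbf{w}\|_2^2}{2K^2\nu_1}\right).$$ Moreover, the individual coordinates $W_i$ of $\mathbf{W}$ satisfy, for $i=1,2,\ldots,k$, $$P(W_i\ge w_i)\le\exp\left(-\frac{w_i^2}{2K^2\nu_1}\right)\quad\text{and}\quad P(W_i\le -w_i)\le\exp\left(-\frac{w_i^2}{2K^2\nu_1}\right).$$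
   Context: Exchangeable means that $(\mathbf{W},\mathbf{W}')$ and $(\mathbf{W}',\mathbf{W})$ have the same distribution. For $\mathbf{a},\mathbf{b}\in\mathbb{R}^k$, $\mathbf{a}\succeq\mathbf{b}$ means $a_i\ge b_i$ for all $1\le i\le k$, and $\mathbf{a}\preceq\mathbf{b}$ means $\mathbf{b}\succeq\mathbf{a}$. $\|\cdot\|_2$ is the Euclidean norm on $\mathbb{R}^k$, $I_k$ is the $k\times k$ identity matrix, and $\boldsymbol{\theta}^t$ is the transpose of $\boldsymbol{\theta}$. *)

(* Defs.v *)
From HB Require Import structures.
From mathcomp Require Import all_boot all_order all_algebra.
From mathcomp Require Import all_classical all_reals all_analysis.
From mathcomp Require complex polyrcf.

Set Implicit Arguments.
Unset Strict Implicit.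
Unset Printing Implicit Defensive.

Import Order.TTheory GRing.Theory Num.Theory.

Local Open Scope classical_set_scope.
Local Open Scope ring_scope.

(* The Borel sigma-algebra of R^k is the library's one on [k.-tuple R];
   matrices carry no measurable structure, so random vectors are tuple-valued
   and [colv] moves them to column vectors for linear algebra. *)
Definition colv (R : realType) (k : nat) (t : k.-tuple R) : 'cV[R]_k :=
  \col_i tnth t i.

(* The library norm on matrices is the sup norm. *)
Definition norm2 (R : realType) (k : nat) (v : 'cV[R]_k) : R :=
  Num.sqrt (\sum_i v i 0 ^+ 2).

Definition vec_ge (R : realType) (k : nat) (a b : 'cV[R]_k) : Prop :=
  forall i, b i 0 <= a i 0.

Definition vec_le (R : realType) (k : nat) (a b : 'cV[R]_k) : Prop :=
  vec_ge b a.

Definition exchangeable (d d' : measure_display) (T : measurableType d)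
    (E : measurableType d') (R : realType) (P : probability T R)
    (X Y : {RV P >-> E}) : Prop :=
  forall A : set (E * E), measurable A ->
    pushforward P (fun t => (X t, Y t)) A = pushforward P (fun t => (Y t, X t)) A.

Arguments exchangeable {d d' T E R} P X Y.

(* [Y] is a version of E(X | Z). *)
Definition is_cond_exp (d d' : measure_display) (T : measurableType d)
    (E : measurableType d') (R : realType) (P : probability T R)
    (Z : {RV P >-> E}) (X Y : T -> R) : Prop :=
  [/\ P.-integrable [set: T] (EFin \o X),
      P.-integrable [set: T] (EFin \o Y),
      measurable_fun [set: g_sigma_algebra_preimageType Z]
        (Y : g_sigma_algebra_preimageType Z -> R)
    & forall A : set T, g_sigma_algebra_preimage Z A ->
        (\int[P]_(t in A) (X t)%:E = \int[P]_(t in A) (Y t)%:E)%E].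

Arguments is_cond_exp {d d' T E R} P Z X Y.

Definition singular_value (R : realType) (n : nat) (A : 'M[R]_n) (s : R) : Prop :=
  0 <= s /\ eigenvalue (A^T *m A) (s ^+ 2).

(* For [0 < n] the infimum is attained, see [sigma_minP]. *)
Definition sigma_min (R : realType) (n : nat) (A : 'M[R]_n) : R :=
  inf [set s | singular_value A s].

Section SigmaMin.
Import complex polyrcf.
Variable R : realType.

Lemma singular_value_ex (n : nat) (A : 'M[R]_n) :
  (0 < n)%N -> exists s, singular_value A s.
Proof.
move=> n0; pose f := real_complex R.
have [a] := @eigenvalue_closed (R[i])%C n (map_mx f (A^T *m A)) n0.
move=> aE; have /eigenvalueP[v vB v0] := aE.
pose c := map_mx (@Num.conj R[i]%C) v.
have nn m (u : 'rV[R[i]%C]_m) :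
    0 <= (u *m (map_mx (@Num.conj R[i]%C) u)^T) 0 0
    /\ ((u *m (map_mx (@Num.conj R[i]%C) u)^T) 0 0 = 0 -> u = 0).
  have -> : (u *m (map_mx (@Num.conj R[i]%C) u)^T) 0 0
      = \sum_i `|u 0 i| ^+ 2.
    by rewrite mxE; apply: eq_bigr => i _; rewrite !mxE normCK.
  split; first by apply: sumr_ge0 => i _; rewrite exprn_ge0.
  move=> /eqP; rewrite psumr_eq0 => [/allP h|i _]; last by rewrite exprn_ge0.
  apply/rowP => i; rewrite mxE; apply/eqP.
  by have := h i (mem_index_enum _); rewrite expf_eq0 /= normr_eq0.
have h1 : (v *m map_mx f (A^T *m A) *m c^T) 0 0 = a * (v *m c^T) 0 0.
  by rewrite vB -scalemxAl mxE.
pose u := v *m map_mx f A^T.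
have h2 : v *m map_mx f (A^T *m A) *m c^T
   = u *m (map_mx (@Num.conj R[i]%C) u)^T.
  rewrite /u /c map_mxM !mulmxA -!mulmxA; congr (_ *m (_ *m _)).
  rewrite map_mxM trmx_mul; congr (_ *m _).
  apply/matrixP => i j; rewrite !mxE.
  by apply/esym/(@conj_Creal R[i]%C)/complex_realP; exists (A i j).
have a0 : 0 <= a.
  have vp : 0 < (v *m c^T) 0 0.
    rewrite lt_neqAle (nn _ v).1 andbT eq_sym.
    by apply: contra_neq v0 => /(nn _ v).2.
  by rewrite -(pmulr_lge0 _ vp) -h1 h2 (nn _ u).1.
have /complex_realP[r ar] : a \is Num.real by exact: ger0_real a0.
have r0 : 0 <= r by rewrite -lecR -ar.
exists (Num.sqrt r); split; first exact: sqrtr_ge0.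
rewrite sqr_sqrtr // eigenvalue_root_char.
by move: aE; rewrite eigenvalue_root_char ar -map_char_poly fmorph_root.
Qed.

Lemma sigma_minP (n : nat) (A : 'M[R]_n) : (0 < n)%N ->
  singular_value A (sigma_min A) /\
  forall s, singular_value A s -> sigma_min A <= s.
Proof.
move=> n0; have lb : has_lbound [set s | singular_value A s].
  by exists 0 => s [].
have p0 : char_poly (A^T *m A) != 0.
  exact/monic_neq0/char_poly_monic.
have rE r : (r \in rootsR (char_poly (A^T *m A))) = eigenvalue (A^T *m A) r.
  by rewrite eigenvalue_root_char -(roots_on_rootsR p0) in_itv.
pose S := [seq Num.sqrt r | r <- rootsR (char_poly (A^T *m A)) & 0 <= r].
have inS s : singular_value A s <-> s \in S.
  split.
    move=> [s0 h]; apply/mapP; exists (s ^+ 2); last by rewrite sqrtr_sqr ger0_norm.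
    by rewrite mem_filter sqr_ge0 rE.
  move=> /mapP[r]; rewrite mem_filter rE => /andP[r0 h] ->.
  by split; [exact: sqrtr_ge0 | rewrite sqr_sqrtr].
have [s0 /inS s0S] := singular_value_ex A n0.
pose m := [arg min_(x < SeqSub s0S) (val (x : seq_sub S))]%O.
have mS : singular_value A (val m) by apply/inS; exact: valP.
have mmin s : singular_value A s -> val m <= s.
  move=> /inS sS; rewrite /m; case: arg_minP => //= i _ /(_ (SeqSub sS)) h.
  exact: h.
have -> : sigma_min A = val m.
  apply/eqP; rewrite eq_le; apply/andP; split.
    exact: ge_inf.
  by apply: lb_le_inf; [exists (val m)| exact: mmin].
by [].
Qed.

End SigmaMin.

(* Main.v *)
Require Import Defs.
From HB Require Import structures.
From mathcomp Require Import all_boot all_order all_algebra.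
From mathcomp Require Import all_classical all_reals all_analysis.
From mathcomp Require Import measurable_realfun ring lra.
From mathcomp Require complex.

(* Write X = u.W, phi(s) = E exp(s X) and choose eta with Lambda^T eta = u, so
   that X = eta.(Lambda W) and |eta| <= nu1 |u|. The regression condition and
   exchangeability give
     E (X exp(s X)) = E (eta.(W - W') exp(s X))
                    = E (eta.(W - W') (exp(s u.W) - exp(s u.W'))) / 2,
   which is at most c s phi(s) with c = nu1 K^2 |u|^2, because
   |exp x - exp y| <= |x - y| (exp x + exp y). By convexity
   phi(s) - phi(t) <= (s - t) E (X exp(s X)), so a discrete Gronwall argument on
   the grid i/n yields phi(1) <= exp(c / 2) without differentiating phi.
   Chernoff's bound then controls P(u.W >= |u|^2), and the four claims are the
   cases u = w, - w, w_i e_i, - w_i e_i. *)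

Set Implicit Arguments.
Unset Strict Implicit.
Unset Printing Implicit Defensive.

Import Order.TTheory GRing.Theory Num.Theory.

Local Open Scope classical_set_scope.
Local Open Scope ring_scope.

(** * Euclidean inner product and the Cauchy-Schwarz inequality *)

Definition dotv (R : realType) (k : nat) (u v : 'cV[R]_k) : R := (u^T *m v) 0 0.

Lemma dotvE (R : realType) (k : nat) (u v : 'cV[R]_k) :
  dotv u v = \sum_i u i 0 * v i 0.
Proof. by rewrite /dotv mxE; apply: eq_bigr => i _; rewrite mxE. Qed.

Lemma norm2_ge0 (R : realType) (k : nat) (v : 'cV[R]_k) : 0 <= norm2 v.
Proof. exact: sqrtr_ge0. Qed.

Lemma norm2_sqr (R : realType) (k : nat) (v : 'cV[R]_k) : norm2 v ^+ 2 = dotv v v.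
Proof.
rewrite /norm2 sqr_sqrtr ?dotvE; last by apply: sumr_ge0 => i _; exact: sqr_ge0.
by apply: eq_bigr => i _; rewrite expr2.
Qed.

Lemma dotv_ge0 (R : realType) (k : nat) (v : 'cV[R]_k) : 0 <= dotv v v.
Proof. by rewrite -norm2_sqr sqr_ge0. Qed.

Lemma dotv_eq0 (R : realType) (k : nat) (v : 'cV[R]_k) :
  (dotv v v == 0) = (v == 0).
Proof.
apply/eqP/eqP => [|->]; last by rewrite /dotv mulmx0 mxE.
move/eqP; rewrite dotvE psumr_eq0 => [/allP h|i _]; last by rewrite -expr2 sqr_ge0.
apply/colP => i; rewrite mxE; apply/eqP.
by have := h i (mem_index_enum _); rewrite mulf_eq0 orbb.
Qed.

Lemma dotvDr (R : realType) (k : nat) (u v w : 'cV[R]_k) :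
  dotv u (v + w) = dotv u v + dotv u w.
Proof. by rewrite /dotv mulmxDr mxE. Qed.

Lemma dotvNr (R : realType) (k : nat) (u v : 'cV[R]_k) : dotv u (- v) = - dotv u v.
Proof. by rewrite /dotv mulmxN mxE. Qed.

Lemma dotvBr (R : realType) (k : nat) (u v w : 'cV[R]_k) :
  dotv u (v - w) = dotv u v - dotv u w.
Proof. by rewrite dotvDr dotvNr. Qed.

Lemma dotvZl (R : realType) (k : nat) (a : R) (u v : 'cV[R]_k) :
  dotv (a *: u) v = a * dotv u v.
Proof. by rewrite /dotv linearZ -scalemxAl mxE. Qed.

Lemma dotvZr (R : realType) (k : nat) (a : R) (u v : 'cV[R]_k) :
  dotv u (a *: v) = a * dotv u v.
Proof. by rewrite /dotv -scalemxAr mxE. Qed.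

Lemma dotvC (R : realType) (k : nat) (u v : 'cV[R]_k) : dotv u v = dotv v u.
Proof. by rewrite !dotvE; apply: eq_bigr => i _; rewrite mulrC. Qed.

Lemma dotv_le_norm2 (R : realType) (k : nat) (u v : 'cV[R]_k) :
  `|dotv u v| <= norm2 u * norm2 v.
Proof.
rewrite -ler_sqr ?nnegrE ?mulr_ge0 ?norm2_ge0// real_normK ?num_real//.
rewrite exprMn !norm2_sqr.
have [->|v0] := eqVneq v 0; first by rewrite /dotv !mulmx0 !mxE expr0n mulr0.
have vv0 : 0 < dotv v v by rewrite lt_def dotv_eq0 v0 dotv_ge0.
(* [c *: v] is the orthogonal projection of [u] onto the line of [v]; Cauchy-Schwarz is the
   nonnegativity of the squared length of the residual [u - c *: v]. *)
pose c := dotv u v / dotv v v.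
have := dotv_ge0 (u - c *: v).
rewrite dotvBr dotvZr !(dotvC (u - c *: v)) !dotvBr !dotvZr (dotvC v u) => h.
have -> : dotv u v ^+ 2 = dotv u u * dotv v v - dotv v v *
    (dotv u u - c * dotv u v - c * (dotv u v - c * dotv v v)).
  by rewrite /c; field; rewrite gt_eqF.
by rewrite lerBlDr lerDl mulr_ge0 // ltW.
Qed.

(** * The smallest singular value as a lower bound for the transpose *)

Section SigmaMinBound.
Import complex.
Local Open Scope sesquilinear_scope.

(** Singular values are defined through [A^T *m A], whereas the norm of [A^T *m v] involves
    [A *m A^T]. A left eigenvector [v] of the latter yields the left eigenvector [v *m A] of the
    former, with the same eigenvalue; invertibility of [A] keeps it nonzero. *)
Lemma eigenvalue_gram_ge (R : realType) (n : nat) (A : 'M[R]_n) (r : R) :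
  A \in unitmx -> eigenvalue (A *m A^T) r -> sigma_min A ^+ 2 <= r.
Proof.
move=> Au /eigenvalueP[v vA v0].
have n0 : (0 < n)%N by case: n A Au v vA v0 => // A _ v _; rewrite thinmx0 eqxx.
have u0 : v *m A != 0.
  by apply: contra v0 => /eqP h; rewrite -(mulmxK Au v) h mul0mx.
have v0' : v^T != 0 by rewrite trmx_eq0.
have r0 : 0 <= r.
  have vv : 0 < dotv v^T v^T by rewrite lt_def dotv_eq0 v0' dotv_ge0.
  rewrite -(pmulr_lge0 _ vv).
  suff -> : r * dotv v^T v^T = dotv (v *m A)^T (v *m A)^T by exact: dotv_ge0.
  rewrite /dotv !trmxK trmx_mul -mulmxA (mulmxA A) (mulmxA v) vA.
  by rewrite -scalemxAl [in RHS]mxE.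
have [[s0 _] smin] := sigma_minP A n0.
have : singular_value A (Num.sqrt r).
  split; first exact: sqrtr_ge0.
  rewrite sqr_sqrtr//; apply/eigenvalueP; exists (v *m A) => //.
  by rewrite !mulmxA -(mulmxA v) vA -scalemxAl.
by move/smin => h; rewrite -(sqr_sqrtr r0) ler_sqr ?nnegrE ?sqrtr_ge0.
Qed.

(** A zero singular value would put a nonzero vector in the left kernel of the invertible matrix
    [A^T *m A]. *)
Lemma sigma_min_gt0 (R : realType) (n : nat) (A : 'M[R]_n) :
  (0 < n)%N -> A \in unitmx -> 0 < sigma_min A.
Proof.
move=> n0 Au; have [[s0 /eigenvalueP[v vA v0]] _] := sigma_minP A n0.
rewrite lt_def s0 andbT; apply: contra_neq v0 => s0'.
have AtA : A^T *m A \in unitmx by rewrite unitmx_mul unitmx_tr Au.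
by rewrite -(mulmxK AtA v) vA s0' expr0n scale0r mul0mx.
Qed.

(** The squared right-hand norm is the quadratic form of [A *m A^T] at [v]. It is diagonalised by
    the complex spectral theorem, and every eigenvalue is at least the square of [sigma_min A]. *)
Lemma sigma_min_norm2 (R : realType) (n : nat) (A : 'M[R]_n) (v : 'cV[R]_n) :
  A \in unitmx -> sigma_min A * norm2 v <= norm2 (A^T *m v).
Proof.
move=> Au; have [n0|n0] := posnP n.
  subst n; rewrite /norm2 big_ord0 sqrtr0 mulr0; exact: sqrtr_ge0.
have [[s0 _] _] := sigma_minP A n0.
rewrite -ler_sqr ?nnegrE ?mulr_ge0 ?norm2_ge0// exprMn !norm2_sqr.
pose f := real_complex R.
pose B := map_mx f (A *m A^T).
have BH : B \is hermsymmx.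
  apply: realsym_hermsym.
    apply/is_hermitianmxP; rewrite expr0 scale1r map_mx_id//.
    by rewrite /B map_trmx trmx_mul trmxK.
  by apply/mxOverP => i j; rewrite mxE; apply/complex_realP; eexists.
have /orthomx_spectralP := hermitian_normalmx BH.
have /mxOverP := hermitian_spectral_diag_real BH.
set D := spectral_diag B; set Q := spectralmx B => Dreal BE.
have Qu : Q \is unitarymx by exact: spectral_unitarymx.
have Qi : Q \in unitmx by exact: spectral_unit.
have QB : Q *m B = diag_mx D *m Q by rewrite {1}BE !mulmxA mulmxV// mul1mx.
(* Row [j] of [Q] is a left eigenvector of [B]. Its eigenvalue is real, so comparing characteristic
   polynomials makes it an eigenvalue of the real matrix [A *m A^T]. *)
have Dge j : f (sigma_min A ^+ 2) <= D 0 j.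
  have /complex_realP[r rE] := Dreal 0 j.
  rewrite rE lecR; apply: eigenvalue_gram_ge => //.
  rewrite eigenvalue_root_char -(fmorph_root f) map_char_poly -eigenvalue_root_char.
  apply/eigenvalueP; exists (row j Q).
    by rewrite -row_mul QB row_mul row_diag_mx -scalemxAl -rowE rE.
  apply/eqP => h; have := mulmxK Qi (delta_mx 0 j : 'rV_n).
  by rewrite -rowE h mul0mx => /matrixP/(_ 0 j)/eqP; rewrite !mxE !eqxx eq_sym oner_eq0.
(* [y] holds the coordinates of [v] in the eigenbasis: [yy] is Parseval's identity and [yDy] the
   diagonal form of the squared norm of [A^T *m v]. *)
pose u := map_mx f v^T; pose y := u *m Q ^t*.
have conju : u ^t* = map_mx f v.
  apply/matrixP => i j; rewrite !mxE.
  by apply: conj_Creal; apply/complex_realP; eexists.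
have yy : f (dotv v v) = \sum_j `|y 0 j| ^+ 2.
  have -> : f (dotv v v) = (y *m y ^t*) 0 0.
    rewrite /y trmx_mul map_mxM trmxCK mulmxA mulmxKtV// conju.
    by rewrite /u -map_mxM mxE.
  by rewrite mxE; apply: eq_bigr => i _; rewrite !mxE normCK.
have yDy : f (dotv (A^T *m v) (A^T *m v)) = \sum_j D 0 j * `|y 0 j| ^+ 2.
  have -> : f (dotv (A^T *m v) (A^T *m v)) = (y *m diag_mx D *m y ^t*) 0 0.
    rewrite /y trmx_mul map_mxM trmxCK conju -(invmx_unitary Qu).
    rewrite !mulmxA -(mulmxA u) -(mulmxA u) -BE.
    rewrite /u -!map_mxM mxE; congr (f (_ 0 0)).
    by rewrite trmx_mul trmxK !mulmxA.
  rewrite mxE; apply: eq_bigr => i _.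
  by rewrite mul_mx_diag !mxE mulrAC -normCK mulrC.
rewrite -lecR -[X in X <= _]/(f _) -[X in _ <= X]/(f _) yDy.
have -> : f (sigma_min A ^+ 2 * dotv v v) = f (sigma_min A ^+ 2) * f (dotv v v).
  exact: rmorphM.
rewrite yy mulr_sumr.
by apply: ler_sum => j _; rewrite ler_wpM2r// exprn_ge0.
Qed.
End SigmaMinBound.

(** * A discrete Gronwall inequality *)

(** The last hypothesis is a difference form of phi' <= c s phi, whose extremal solution is exp(c
    s^2 / 2). Iterating it over the grid i/n gives an exponent that tends to c/2 at the endpoint as
    n grows. *)
Lemma gronwall_gaussian (R : realType) (phi : R -> R) (c : R) :
  0 <= c -> phi 0 = 1 -> (forall s, 0 <= phi s) ->
  (forall s t, 0 <= t <= s -> phi s - phi t <= (s - t) * (c * s * phi s)) ->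
  phi 1 <= expR (c / 2).
Proof.
move=> c0 phi0 phi_ge0 phiB.
have step (n i : nat) : c < n%:R -> (i <= n)%N ->
    phi (i%:R / n%:R) <= expR (c / (n%:R * (n%:R - c)) * (i%:R * (i%:R + 1) / 2)).
  move=> cn; have n0 : 0 < n%:R :> R := le_lt_trans c0 cn.
  have nc0 : 0 < n%:R - c by rewrite subr_gt0.
  elim: i => [_|i IH lein]; first by rewrite !mul0r mulr0 expR0 phi0.
  set m : R := n%:R in cn n0 nc0 IH *.
  have im : (i.+1)%:R <= m by rewrite ler_nat.
  have i0 : 0 <= i%:R :> R by [].
  have i1 : (i.+1)%:R = i%:R + 1 :> R by rewrite -natr1.
  rewrite i1 in im *.
  have := phiB ((i%:R + 1) / m) (i%:R / m).
  have -> : 0 <= i%:R / m <= (i%:R + 1) / m.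
    by rewrite divr_ge0 ?(ltW n0)//= ler_pM2r ?invr_gt0// lerDl.
  move=> /(_ isT); set p := phi ((i%:R + 1) / m) => pB.
  (* One grid step reads (1 - x) phi((i+1)/m) <= phi(i/m); since i + 1 <= m, x is at most c/m < 1,
     so division by 1 - x is allowed. *)
  set x := c * (i%:R + 1) / m ^+ 2.
  have xE : (1 - x) * p <= phi (i%:R / m).
    rewrite -subr_ge0; rewrite -subr_ge0 in pB.
    rewrite (_ : _ - _ = ((i%:R + 1) / m - i%:R / m) * (c * ((i%:R + 1) / m) * p) -
         (p - phi (i%:R / m)))//.
    by rewrite /x; field; rewrite gt_eqF.
  have xc : x <= c / m.
    rewrite /x expr2 invfM mulrA ler_pM2r ?invr_gt0// -mulrA ler_piMr//.
    by rewrite ler_pdivrMr ?mul1r.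
  have cm1 : 0 < 1 - c / m by rewrite subr_gt0 ltr_pdivrMr ?mul1r.
  have x1 : 0 < 1 - x by apply: (lt_le_trans cm1); rewrite lerB.
  have x0 : 0 <= x by rewrite /x divr_ge0// ?mulr_ge0 ?addr_ge0// exprn_ge0// ltW.
  have {xE}pE : p <= expR (x / (1 - x)) * phi (i%:R / m).
    rewrite mulrC in xE; rewrite -ler_pdivlMr// in xE; apply: (le_trans xE).
    rewrite mulrC ler_wpM2r//.
    (* Here 1 / (1 - x) = 1 + x / (1 - x). *)
    apply: le_trans (expR_ge1Dx _).
    by rewrite le_eqVlt; apply/orP; left; apply/eqP; field; rewrite gt_eqF.
  apply: (le_trans pE).
  apply: le_trans (_ : expR (x / (1 - c / m)) *
    expR (c / (m * (m - c)) * (i%:R * (i%:R + 1) / 2)) <= _).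
    apply: ler_pM; [exact: expR_ge0|exact: phi_ge0| |exact: IH (ltnW lein)].
    by rewrite ler_expR ler_wpM2l// lef_pV2 ?posrE// lerB.
  rewrite -expRD ler_expR le_eqVlt; apply/orP; left; apply/eqP; rewrite /x; field.
  by rewrite !gt_eqF.
have step1 (n : nat) : c < n%:R -> phi 1 <= expR (c / 2 * ((n%:R + 1) / (n%:R - c))).
  move=> cn; have := step n n cn (leqnn n).
  have n0 : n%:R != 0 :> R by rewrite gt_eqF// (le_lt_trans c0 cn).
  have nc0 : n%:R - c != 0 by rewrite gt_eqF// subr_gt0.
  rewrite divff//; congr (_ <= expR _); field; exact/andP.
have [p0|p0] := leP (phi 1) 0; first exact: le_trans p0 (expR_ge0 _).
rewrite -[phi 1]lnK ?posrE// ler_expR leNgt; apply/negP => Lc.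
set L := ln (phi 1) in Lc.
have Lc0 : 0 < L - c / 2 by rewrite subr_gt0.
have L0 : 0 < L by apply: le_lt_trans Lc; rewrite divr_ge0.
have D0 : 0 <= (L * c + c / 2) / (L - c / 2).
  by rewrite divr_ge0 ?(ltW Lc0)// addr_ge0 ?mulr_ge0 ?divr_ge0// ltW.
(* If [L] exceeded c/2, [step1] would give (L - c/2) n <= L c + c/2 for every n > c. The summand [c]
   secures n > c, and the quotient makes this inequality fail. *)
have [n Hn] : exists n : nat, c + (L * c + c / 2) / (L - c / 2) < n%:R.
  by eexists; apply: archi_boundP; exact: addr_ge0.
have cn : c < n%:R by apply: le_lt_trans Hn; rewrite lerDl.
have := step1 n cn; rewrite -[phi 1]lnK ?posrE// ler_expR -/L.
rewrite mulrA ler_pdivlMr ?subr_gt0// => h.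
have : (L * c + c / 2) / (L - c / 2) < n%:R by apply: le_lt_trans Hn; rewrite lerDr.
rewrite ltr_pdivrMr// => h2; lra.
Qed.

(** * Elementary inequalities for the exponential *)

(** For y <= x the tangent at x gives exp x - exp y <= (x - y) exp x. The sum of exponentials on the
    right makes the bound symmetric, which suits the exchange of [W] and [W']. *)
Lemma expR_sub_le (R : realType) (x y : R) :
  `|expR x - expR y| <= `|x - y| * (expR x + expR y).
Proof.
wlog xy : x y / y <= x => [H|].
  have [/H//|/ltW/H] := leP y x.
  by rewrite (distrC (expR x)) (distrC x y) (addrC (expR x)).
have h := expR_ge1Dx (y - x).
rewrite !ger0_norm ?subr_ge0 ?ler_expR//.
apply: (@le_trans _ _ ((x - y) * expR x)); last first.
  by rewrite ler_wpM2l ?subr_ge0// lerDl expR_ge0.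
have -> : expR y = expR x * expR (y - x) by rewrite -expRD addrC subrK.
rewrite -subr_ge0.
have := expR_ge0 x.
nra.
Qed.

(** Convexity of s -> exp(s x): the graph lies above its tangent at s. *)
Lemma expR_tangent (R : realType) (s t x : R) :
  expR (s * x) - expR (t * x) <= (s - t) * (x * expR (s * x)).
Proof.
have h := expR_ge1Dx (t * x - s * x).
have -> : expR (t * x) = expR (s * x) * expR (t * x - s * x).
  by rewrite -expRD addrC subrK.
have := expR_ge0 (s * x).
nra.
Qed.

(** Follows from |x| <= exp x + exp(-x); it makes X exp(s X) integrable once all exponential moments
    are finite. *)
Lemma normr_expR_le (R : realType) (s x : R) :
  `|x| * expR (s * x) <= expR ((s + 1) * x) + expR ((s - 1) * x).
Proof.
rewrite mulrDl mulrBl mul1r !expRD -mulrDr mulrC ler_wpM2l ?expR_ge0//.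
have h1 := expR_ge1Dx x; have h2 := expR_ge1Dx (- x).
have := expR_ge0 x; have := expR_ge0 (- x).
by case: (ler0P x) => _; lra.
Qed.

(** * Invariance of expectations under swapping an exchangeable pair *)

Section Exchangeable.
Context (d d' : measure_display) (T : measurableType d) (E : measurableType d').
Context (R : realType) (P : probability T R) (X Y : {RV P >-> E}).
Hypothesis XY : exchangeable P X Y.
Local Open Scope ereal_scope.

Let mXY : measurable_fun [set: T] (fun t => (X t, Y t)).
Proof. exact: measurable_fun_pair. Qed.

Let mYX : measurable_fun [set: T] (fun t => (Y t, X t)).
Proof. exact: measurable_fun_pair. Qed.

Lemma exchangeable_ge0_integral (F : E * E -> \bar R) :
  measurable_fun [set: E * E] F -> (forall z, 0 <= F z) ->
  \int[P]_t F (X t, Y t) = \int[P]_t F (Y t, X t).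
Proof.
move=> mF F0.
have := ge0_integral_pushforward mXY P measurableT mF (fun z _ => F0 z).
have := ge0_integral_pushforward mYX P measurableT mF (fun z _ => F0 z).
rewrite !preimage_setT => <- <-.
by apply: eq_measure_integral => A mA _; exact: XY.
Qed.

Lemma exchangeable_integrable (F : E * E -> \bar R) :
  measurable_fun [set: E * E] F ->
  P.-integrable [set: T] (fun t => F (X t, Y t)) ->
  P.-integrable [set: T] (fun t => F (Y t, X t)).
Proof.
move=> mF /integrableP[_ iF]; apply/integrableP; split.
  exact: (measurableT_comp mF mYX).
rewrite -(@exchangeable_ge0_integral (abse \o F))//.
  by apply: measurableT_comp.
by move=> z; exact: abse_ge0.
Qed.

Lemma exchangeable_integral (F : E * E -> \bar R) :
  measurable_fun [set: E * E] F ->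
  P.-integrable [set: T] (fun t => F (X t, Y t)) ->
  \int[P]_t F (X t, Y t) = \int[P]_t F (Y t, X t).
Proof.
move=> mF iF.
have := integral_pushforward mXY mF iF measurableT.
have := integral_pushforward mYX mF (exchangeable_integrable mF iF) measurableT.
rewrite !preimage_setT => <- <-.
by apply: eq_measure_integral => A mA _; exact: XY.
Qed.

End Exchangeable.

(** * Orthogonality to functions of the conditioning variable *)

Section SigmaOrthogonal.
Import HBNNSimple.
Context (d d' : measure_display) (T : measurableType d) (E : measurableType d').
Context (R : realType) (P : probability T R) (Z : {RV P >-> E}).
Local Open Scope ereal_scope.

(** Vanishing on the events of sigma(Z) extends by linearity to simple functions of [Z], then to [f]
    by dominated convergence: the approximants stay below [f], so |D f(Z)| dominates. *)
Lemma integral_mulr_preimage_eq0 (D : T -> R) (f : E -> R) :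
  P.-integrable [set: T] (EFin \o D) ->
  (forall A, g_sigma_algebra_preimage Z A -> \int[P]_(t in A) (D t)%:E = 0) ->
  measurable_fun [set: E] f -> (forall x, (0 <= f x)%R) ->
  P.-integrable [set: T] (fun t => (D t * f (Z t))%:E) ->
  \int[P]_t (D t * f (Z t))%:E = 0.
Proof.
move=> iD D0 mf f0 iDf.
have mD : measurable_fun [set: T] D.
  by apply/measurable_EFinP; exact: measurable_int iD.
have mEf : measurable_fun [set: E] (EFin \o f) by exact/measurable_EFinP.
pose g := nnsfun_approx measurableT mEf.
have mgZ n : measurable_fun [set: T] (fun t => g n (Z t)).
  by apply: measurableT_comp => //; exact: measurable_funP.
have gf n x : (g n x <= f x)%R.
  rewrite -lee_fin (_ : g n x = approx (T := E) setT (EFin \o f) n x).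
    by apply: (le_approx (f := EFin \o f)) => // y _; rewrite lee_fin.
  by rewrite /g nnsfun_approxE.
have intg n : \int[P]_t (D t * g n (Z t))%:E = 0.
  (* [s] lists the finitely many values of [g n]; the sets [A i] are the corresponding level sets
     pulled back by [Z], hence events of sigma(Z). *)
  pose s : seq R := finmap.enum_fset (fset_set (range (g n))).
  pose A i := Z @^-1` (g n @^-1` [set s`_i]%R).
  have mA i : measurable (A i).
    apply: (measurable_funPTI Z).
    exact: measurable_funPTI.
  have gE t : (D t * g n (Z t))%:E =
      \sum_(i < size s) ((s`_i)%R%:E * ((EFin \o D) \_ (A i)) t).
    rewrite fimfunEord mulr_sumr -sumEFin; apply: eq_bigr => i _.
    rewrite restrict_EFin -EFinM mulrCA; congr (_ * _)%:E.
    rewrite indicE -[Z t \in _]/(t \in A i) patchE.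
    by case: ifP => _; rewrite ?mulr1 ?mulr0.
  under eq_integral do rewrite gE.
  have iA i : P.-integrable setT ((EFin \o D) \_ (A i)).
    apply/(integrable_mkcond _ (mA i)).
    exact: (integrableS measurableT (mA i) (@subsetT _ _) iD).
  rewrite integral_sum//; last by move=> i; exact: integrableZl.
  rewrite big1// => i _.
  rewrite integralZl// -integral_mkcond D0 ?mule0//.
  by exists (g n @^-1` [set s`_i]%R); [exact: measurable_funPTI|rewrite setTI].
have [||||| _ _] := @dominated_convergence _ _ _ P setT measurableT
  (fun n t => (D t * g n (Z t))%:E) (fun t => (D t * f (Z t))%:E)
  (fun t => `|(D t * f (Z t))%:E|).
- by move=> n; apply/measurable_EFinP; exact: measurable_funM.
- exact: measurable_int iDf.
- apply: aeW => t _; under eq_fun do rewrite EFinM.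
  rewrite EFinM; apply: cvgeZl => //.
  by apply: (cvg_nnsfun_approx measurableT mEf) => // x _; rewrite lee_fin.
- exact: integrable_abse.
- apply: aeW => t n _; rewrite lee_fin !normrM ler_wpM2l//.
  by rewrite !ger0_norm.
move=> /cvg_lim <-//.
under eq_fun do rewrite intg.
by rewrite lim_cst.
Qed.

End SigmaOrthogonal.

(** * Integral comparison under almost sure bounds *)

Lemma ae_le_Rintegral (d : measure_display) (T : measurableType d) (R : realType)
    (mu : {measure set T -> \bar R}) (f g : T -> R) :
  mu.-integrable [set: T] (EFin \o f) -> mu.-integrable [set: T] (EFin \o g) ->
  {ae mu, forall t, f t <= g t} ->
  \int[mu]_t f t <= \int[mu]_t g t.
Proof.
move=> fi gi fg; rewrite -subr_ge0 -RintegralB//.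
have mfg : measurable_fun [set: T] (fun t => g t - f t).
  apply: measurable_funB; apply/measurable_EFinP.
    exact: measurable_int gi.
  exact: measurable_int fi.
(* Almost everywhere [g - f] equals its positive part, which is nonnegative at every point. *)
rewrite /Rintegral (ae_eq_integral (fun t => (Num.max (g t - f t) 0)%:E))//.
- by apply: fine_ge0; apply: integral_ge0 => t _; rewrite lee_fin le_max lexx orbT.
- exact/measurable_EFinP.
- by apply/measurable_EFinP; exact: measurable_maxr.
- by apply: filterS fg => t fgt _ /=; rewrite max_l// subr_ge0.
Qed.

Lemma integrable_ae_bounded_mul (d : measure_display) (T : measurableType d)
    (R : realType) (mu : {measure set T -> \bar R}) (f g : T -> R) (C : R) :
  measurable_fun [set: T] g -> {ae mu, forall t, `|g t| <= C} ->
  mu.-integrable [set: T] (EFin \o f) ->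
  mu.-integrable [set: T] (fun t => (g t * f t)%:E).
Proof.
move=> mg gC fi; have mf : measurable_fun [set: T] f.
  by apply/measurable_EFinP; exact: measurable_int fi.
have /integrableP[_ Cfi] := integrableZl measurableT C fi.
apply/integrableP; split; first by apply/measurable_EFinP; exact: measurable_funM.
apply: le_lt_trans Cfi; apply: ae_ge0_le_integral => //.
- by apply/measurable_EFinP; apply: measurableT_comp => //; exact: measurable_funM.
- by apply/measurable_EFinP; apply: measurableT_comp => //; exact: measurable_funM.
- apply: filterS gC => t gCt _ /=; rewrite lee_fin !normrM ler_wpM2r//.
  exact: le_trans gCt (ler_norm _).
Qed.

Lemma measurable_dotv_colv (R : realType) (k : nat) (u : 'cV[R]_k) :
  measurable_fun [set: k.-tuple R] (fun x => dotv u (colv x)).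
Proof.
under eq_fun do rewrite dotvE; apply: measurable_sum => i.
apply: measurable_funM => //; under eq_fun do rewrite mxE.
exact: measurable_tnth.
Qed.

(** * Gaussian bound on the moment generating function, and Chernoff's bound *)

Section MomentGeneratingFunction.
Context (R : realType) (d : measure_display) (T : measurableType d).
Context (P : probability T R) (k : nat) (W W' : {RV P >-> k.-tuple R}).
Context (Lambda : 'M[R]_k) (K : R).
Hypothesis hk : (0 < k)%N.
Hypothesis hexch : exchangeable P W W'.
Hypothesis hLambda : Lambda \in unitmx.
Hypothesis hcond : forall i : 'I_k,
  is_cond_exp P W (fun t => tnth (W' t) i)
    (fun t => ((1%:M - Lambda) *m colv (W t)) i 0).
Hypothesis hK : 0 < K.
Hypothesis hbound : {ae P, forall t, norm2 (colv (W t) - colv (W' t)) <= K}.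
Hypothesis hmgf : forall theta : 'cV[R]_k,
  ('E_P[fun t => expR ((theta^T *m colv (W t)) 0 0)%R] < +oo)%E.

Let mW u : measurable_fun [set: T] (fun t => dotv u (colv (W t))).
Proof. by apply: (measurableT_comp (measurable_dotv_colv u)). Qed.

Let mW' u : measurable_fun [set: T] (fun t => dotv u (colv (W' t))).
Proof. by apply: (measurableT_comp (measurable_dotv_colv u)). Qed.

Let mgf_integrable u s :
  P.-integrable [set: T] (fun t => (expR (s * dotv u (colv (W t))))%:E).
Proof.
apply/integrableP; split.
  apply/measurable_EFinP; apply: measurableT_comp => //; exact: measurable_funM.
have := hmgf (s *: u); rewrite unlock; apply: le_lt_trans.
rewrite le_eqVlt; apply/orP; left; apply/eqP; apply: eq_integral => t _.
by rewrite -[(_^T *m _) 0 0]/(dotv (s *: u) _) dotvZl /= ger0_norm// expR_ge0.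
Qed.

Let mF u s : measurable_fun [set: k.-tuple R * k.-tuple R]
  (fun z => (expR (s * dotv u (colv z.1)))%:E).
Proof.
apply/measurable_EFinP; apply: measurableT_comp => //.
apply: measurable_funM => //.
exact: (measurableT_comp (measurable_dotv_colv u) measurable_fst).
Qed.

Let mgf_integrable' u s :
  P.-integrable [set: T] (fun t => (expR (s * dotv u (colv (W' t))))%:E).
Proof. exact: (exchangeable_integrable hexch (mF u s) (mgf_integrable u s)). Qed.

Let mgf_eq u s : \int[P]_t expR (s * dotv u (colv (W' t))) =
                 \int[P]_t expR (s * dotv u (colv (W t))).
Proof.
congr fine; apply/esym.
exact: (exchangeable_integral hexch (mF u s) (mgf_integrable u s)).
Qed.

Let dmgf_integrable u s : P.-integrable [set: T]
  (fun t => (dotv u (colv (W t)) * expR (s * dotv u (colv (W t))))%:E).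
Proof.
have := integrableD measurableT (mgf_integrable u (s + 1)) (mgf_integrable u (s - 1)).
apply: le_integrable => //.
  apply/measurable_EFinP; apply: measurable_funM => //.
  by apply: measurableT_comp => //; exact: measurable_funM.
move=> t _; rewrite lee_fin normrM (ger0_norm (expR_ge0 _)).
apply: le_trans (normr_expR_le _ _) _; exact: ler_norm.
Qed.

Let dot_diff_ae u : {ae P, forall t,
  `|dotv u (colv (W t) - colv (W' t))| <= norm2 u * K}.
Proof.
apply: filterS hbound => t Kt; apply: le_trans (dotv_le_norm2 _ _) _.
by rewrite ler_wpM2l// norm2_ge0.
Qed.

Let mdiff u : measurable_fun [set: T] (fun t => dotv u (colv (W t) - colv (W' t))).
Proof. by under eq_fun do rewrite dotvBr; apply: measurable_funB; [exact: mW|exact: mW']. Qed.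

(* [Lambda^T *m eta = u] means [dotv u x = dotv eta (Lambda *m x)]. *)
Let regression eta u s : Lambda^T *m eta = u ->
  \int[P]_t (dotv u (colv (W t)) * expR (s * dotv u (colv (W t)))) =
  \int[P]_t (dotv eta (colv (W t) - colv (W' t)) * expR (s * dotv u (colv (W t)))).
Proof.
move=> eta_u.
(* [D] is eta.(W' - E(W' | W)), so it integrates to zero over the events of sigma(W); [DE] rewrites
   it as u.W - eta.(W - W'). *)
pose D t := dotv eta (colv (W' t)) - dotv eta ((1%:M - Lambda) *m colv (W t)).
have DE t : D t = dotv u (colv (W t)) - dotv eta (colv (W t) - colv (W' t)).
  rewrite /D mulmxBl mul1mx !dotvBr -eta_u /dotv trmx_mul trmxK mulmxA; ring.
pose Y i t := ((1%:M - Lambda) *m colv (W t)) i 0.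
pose Di i t := ((tnth (W' t) i)%:E - (Y i t)%:E)%E.
have DEsum t : (D t)%:E = (\sum_i (eta i 0)%:E * Di i t)%E.
  rewrite /D -dotvBr dotvE -sumEFin; apply: eq_bigr => i _.
  rewrite /Di -EFinB -EFinM; congr (_ * _)%:E.
  by rewrite [LHS]mxE [X in X + _]mxE [X in _ + X]mxE.
have iDi i : P.-integrable [set: T] (Di i).
  by apply: integrableB => //; have [] := hcond i.
have iD : P.-integrable [set: T] (EFin \o D).
  have -> : EFin \o D = (fun t => \sum_i (eta i 0)%:E * Di i t)%E by exact/funext.
  by apply: integrable_sum => // i _; exact: integrableZl.
have D0 A : g_sigma_algebra_preimage W A -> (\int[P]_(t in A) (D t)%:E = 0)%E.
  move=> WA; have mA : measurable A.
    by case: WA => B mB <-; rewrite setTI; exact: measurable_funPTI.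
  have sub f : P.-integrable [set: T] f -> P.-integrable A f.
    exact: (integrableS measurableT mA (@subsetT _ _)).
  under eq_integral => t _ do rewrite DEsum.
  rewrite integral_sum//; last by move=> i; apply/integrableZl/sub.
  rewrite big1// => i _; rewrite integralZl//; last exact/sub.
  have [iW' iY _ /(_ A WA) W'Y] := hcond i.
  rewrite integralB//; [|exact/sub|exact/sub].
  by rewrite W'Y subee ?mule0//; apply: integrable_fin_num => //; exact/sub.
have iG := integrable_ae_bounded_mul (mdiff eta) (dot_diff_ae eta) (mgf_integrable u s).
have iX := dmgf_integrable u s.
pose h (x : k.-tuple R) := expR (s * dotv u (colv x)).
have mh : measurable_fun [set: k.-tuple R] h.
  apply: measurableT_comp => //; apply: measurable_funM => //.
  exact: measurable_dotv_colv.
have h0 x : 0 <= h x by exact: expR_ge0.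
have DhE t : D t * h (W t) = dotv u (colv (W t)) * h (W t) -
    dotv eta (colv (W t) - colv (W' t)) * h (W t) by rewrite DE mulrBl.
have iDh : P.-integrable [set: T] (fun t => (D t * h (W t))%:E).
  by under eq_fun do rewrite DhE EFinB; exact: (integrableB measurableT iX iG).
have := integral_mulr_preimage_eq0 iD D0 mh h0 iDh.
under eq_integral do rewrite DhE.
move=> /(congr1 fine); rewrite [LHS]RintegralB// => /eqP.
by rewrite subr_eq0 => /eqP.
Qed.

(* By exchangeability half of the integral on the right-hand side of
   [regression] can be replaced by its image under swapping [W] and [W']. *)
Let symmetrized eta u s :
  \int[P]_t (dotv eta (colv (W t) - colv (W' t)) * expR (s * dotv u (colv (W t)))) =
  \int[P]_t (dotv eta (colv (W t) - colv (W' t)) *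
    (expR (s * dotv u (colv (W t))) - expR (s * dotv u (colv (W' t))))) / 2.
Proof.
have iG := integrable_ae_bounded_mul (mdiff eta) (dot_diff_ae eta) (mgf_integrable u s).
have iG' := integrable_ae_bounded_mul (mdiff eta) (dot_diff_ae eta) (mgf_integrable' u s).
under [in RHS]eq_Rintegral do rewrite mulrBr.
rewrite RintegralB//.
set I := \int[P]_t _; suff -> : \int[P]_t (dotv eta (colv (W t) - colv (W' t)) *
    expR (s * dotv u (colv (W' t)))) = - I by field.
(* Swapping the arguments of [F] turns [I] into the integral of eta.(W' - W) exp(s u.W'), which is
   the negative of the integral sought. *)
pose F (z : k.-tuple R * k.-tuple R) :=
  (dotv eta (colv z.1 - colv z.2) * expR (s * dotv u (colv z.1)))%:E.
have mF' : measurable_fun [set: k.-tuple R * k.-tuple R] F.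
  apply/measurable_EFinP; apply: measurable_funM; last by apply/measurable_EFinP; exact: mF.
  under eq_fun do rewrite dotvBr; apply: measurable_funB.
    exact: (measurableT_comp (measurable_dotv_colv eta) measurable_fst).
  exact: (measurableT_comp (measurable_dotv_colv eta) measurable_snd).
have -> : I = \int[P]_t (dotv eta (colv (W' t) - colv (W t)) *
    expR (s * dotv u (colv (W' t)))).
  rewrite /I /Rintegral -[LHS]/(fine (\int[P]_t F (W t, W' t))%E).
  by rewrite (exchangeable_integral hexch mF' iG).
rewrite -[RHS]mulN1r -RintegralZl//; last first.
  exact: (exchangeable_integrable hexch mF' iG).
by apply: eq_Rintegral => t _; rewrite -opprB dotvNr mulNr mulN1r.
Qed.

(** This is the differential inequality phi'(s) <= c s phi(s), with the derivative written as an
    expectation and c = K^2 |u|^2 / sigma_min(Lambda). *)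
Let dmgf_le u s : 0 <= s ->
  \int[P]_t (dotv u (colv (W t)) * expR (s * dotv u (colv (W t)))) <=
  K ^+ 2 / sigma_min Lambda * norm2 u ^+ 2 * s * \int[P]_t expR (s * dotv u (colv (W t))).
Proof.
move=> s0.
have sg0 := sigma_min_gt0 hk hLambda.
pose eta := invmx Lambda^T *m u.
have eta_u : Lambda^T *m eta = u by rewrite mulKVmx ?unitmx_tr.
have eta_le : norm2 eta <= norm2 u / sigma_min Lambda.
  by rewrite ler_pdivlMr// mulrC -[in leRHS]eta_u sigma_min_norm2.
rewrite (regression _ eta_u) symmetrized.
set phi := \int[P]_t expR _.
have iG := integrable_ae_bounded_mul (mdiff eta) (dot_diff_ae eta) (mgf_integrable u s).
have iG' := integrable_ae_bounded_mul (mdiff eta) (dot_diff_ae eta) (mgf_integrable' u s).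
have iS : P.-integrable [set: T] (fun t => (expR (s * dotv u (colv (W t))) +
    expR (s * dotv u (colv (W' t))))%:E).
  exact: (integrableD measurableT (mgf_integrable u s) (mgf_integrable' u s)).
have iB : P.-integrable [set: T] (fun t => (dotv eta (colv (W t) - colv (W' t)) *
    (expR (s * dotv u (colv (W t))) - expR (s * dotv u (colv (W' t)))))%:E).
  under eq_fun do rewrite mulrBr EFinB.
  exact: (integrableB measurableT iG iG').
(* The first factor bounds |eta.(W - W')|, the second |s u.(W - W')|, both almost surely. The two
   exponentials left by [expR_sub_le] each integrate to [phi], which absorbs the division by 2. *)
pose C := norm2 eta * K * (s * (norm2 u * K)).
apply: (@le_trans _ _ (C * (phi + phi) / 2)).
  have -> : phi + phi = \int[P]_t (expR (s * dotv u (colv (W t))) +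
      expR (s * dotv u (colv (W' t)))).
    rewrite RintegralD; [|exact: measurableT|exact: mgf_integrable|exact: mgf_integrable'].
    by rewrite [X in _ = _ + X]mgf_eq.
  rewrite ler_pM2r// -RintegralZl//.
  apply: ae_le_Rintegral.
  - exact: iB.
  - exact: (integrableZl measurableT C iS).
  - apply: filterS2 (dot_diff_ae eta) (dot_diff_ae u) => t eta_t u_t.
    apply: le_trans (ler_norm _) _; rewrite normrM /C -mulrA.
    apply: ler_pM => //; apply: le_trans (expR_sub_le _ _) _.
    rewrite ler_wpM2r ?addr_ge0 ?expR_ge0//.
    by rewrite -mulrBr normrM ger0_norm// ler_wpM2l// -dotvBr.
have phi0 : 0 <= phi by apply: Rintegral_ge0 => t _; exact: expR_ge0.
rewrite (_ : C * (phi + phi) / 2 = C * phi); last by field.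
rewrite ler_wpM2r//.
rewrite (_ : _ * s = norm2 u / sigma_min Lambda * K * (s * (norm2 u * K))); last first.
  by field; rewrite gt_eqF.
have K0 := ltW hK.
rewrite /C ler_wpM2r ?mulr_ge0 ?norm2_ge0// ler_wpM2r//.
Qed.

Lemma mgf_le u : \int[P]_t expR (dotv u (colv (W t))) <=
  expR (K ^+ 2 / sigma_min Lambda * norm2 u ^+ 2 / 2).
Proof.
pose phi s := \int[P]_t expR (s * dotv u (colv (W t))).
have -> : \int[P]_t expR (dotv u (colv (W t))) = phi 1.
  by apply: eq_Rintegral => t _; rewrite mul1r.
have phi_ge0 s : 0 <= phi s by apply: Rintegral_ge0 => t _; exact: expR_ge0.
apply: gronwall_gaussian => //.
- by rewrite mulr_ge0 ?sqr_ge0// divr_ge0 ?sqr_ge0// ltW ?sigma_min_gt0.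
- rewrite /phi; under eq_Rintegral do rewrite mul0r expR0.
  by rewrite Rintegral_cst//= probability_setT mulr1.
move=> s t /andP[t0 ts].
(* The tangent inequality, integrated, bounds the increment of [phi]; [dmgf_le] then bounds the
   resulting expectation. *)
apply: (@le_trans _ _ ((s - t) *
  \int[P]_x (dotv u (colv (W x)) * expR (s * dotv u (colv (W x)))))); last first.
  by rewrite ler_wpM2l ?subr_ge0// dmgf_le// (le_trans t0).
rewrite -(RintegralZl (s - t) measurableT (dmgf_integrable u s)).
rewrite -(RintegralB measurableT (mgf_integrable u s) (mgf_integrable u t)).
apply: le_Rintegral => //.
- exact: (integrableB measurableT (mgf_integrable u s) (mgf_integrable u t)).
- exact: (integrableZl measurableT (s - t) (dmgf_integrable u s)).
- by move=> x _; exact: expR_tangent.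
Qed.


(** Chernoff's bound for u.W at level a = |u|^2. The parameter r = sigma_min(Lambda) / K^2 minimises
    the exponent K^2 r^2 a / (2 sigma_min(Lambda)) - r a. *)
Lemma dotv_tail u : (P [set t | (norm2 u ^+ 2 <= dotv u (colv (W t)))%R]
  <= (expR (- (norm2 u ^+ 2 / (2 * K ^+ 2 * (1 / sigma_min Lambda)))))%R%:E)%E.
Proof.
have sg0 := sigma_min_gt0 hk hLambda.
pose r := sigma_min Lambda / K ^+ 2.
have r0 : 0 < r by rewrite divr_gt0 ?exprn_gt0.
pose X : {RV P >-> R} := HB.pack (fun t => dotv u (colv (W t)))
  (isMeasurableFun.Build _ _ _ _ _ (mW u)).
apply: (le_trans (chernoff X (norm2 u ^+ 2) r0)).
have -> : ('M_P X r = (\int[P]_t expR (dotv (r *: u) (colv (W t))))%:E)%E.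
  rewrite /mmt_gen_fun unlock /Rintegral fineK.
    by apply: eq_integral => t _; rewrite /= dotvZl mulrC.
  apply: integrable_fin_num => //.
  by under eq_fun do rewrite dotvZl; exact: mgf_integrable.
rewrite -EFinM lee_fin.
apply: le_trans (ler_wpM2r (expR_ge0 _) (mgf_le _)) _.
rewrite -expRD ler_expR le_eqVlt; apply/orP; left; apply/eqP.
rewrite !norm2_sqr dotvZl dotvZr /r; field.
by rewrite !gt_eqF.
Qed.

End MomentGeneratingFunction.

(** * Tail bounds for orthants and coordinates *)

Theorem theorem2p1 (R : realType) (d : measure_display) (T : measurableType d)
    (P : probability T R) (k : nat) (hk : (1 <= k)%N)
    (W W' : {RV P >-> k.-tuple R}) (Lambda : 'M[R]_k) (K : R)
    (hexch : exchangeable P W W')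
    (hLambda : Lambda \in unitmx)
    (hcond : forall i : 'I_k,
       is_cond_exp P W (fun t => tnth (W' t) i)
         (fun t => ((1%:M - Lambda) *m colv (W t)) i 0))
    (hK : 0 < K)
    (hbound : {ae P, forall t, norm2 (colv (W t) - colv (W' t)) <= K})
    (hmgf : forall theta : 'cV[R]_k,
       ('E_P[fun t => expR ((theta^T *m colv (W t)) 0 0)%R] < +oo)%E)
    (w : 'cV[R]_k) (hw : vec_ge w 0) :
  let nu1 := 1 / sigma_min Lambda in
  [/\ (P [set t | vec_ge (colv (W t)) w]
        <= (expR (- (norm2 w ^+ 2 / (2 * K ^+ 2 * nu1))))%R%:E)%E,
      (P [set t | vec_le (colv (W t)) (- w)%R]
        <= (expR (- (norm2 w ^+ 2 / (2 * K ^+ 2 * nu1))))%R%:E)%E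
    & forall i : 'I_k,
        (P [set t | (w i 0 <= tnth (W t) i)%R]
          <= (expR (- (w i 0 ^+ 2 / (2 * K ^+ 2 * nu1))))%R%:E)%E /\
        (P [set t | (tnth (W t) i <= - w i 0)%R]
          <= (expR (- (w i 0 ^+ 2 / (2 * K ^+ 2 * nu1))))%R%:E)%E].
Proof.
move=> nu1; pose tail := dotv_tail hk hexch hLambda hcond hK hbound hmgf.
have mWi i : measurable_fun [set: T] (fun t => tnth (W t) i).
  exact: (measurableT_comp (measurable_tnth i) (measurable_funP W)).
have mge (f : T -> R) c : measurable_fun [set: T] f -> measurable [set t | c <= f t].
  move=> mf; rewrite -[X in measurable X]setTI.
  by rewrite -(preimage_itvcy f c); exact: mf.
have mle (f : T -> R) c : measurable_fun [set: T] f -> measurable [set t | f t <= c].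
  move=> mf; rewrite -[X in measurable X]setTI.
  by rewrite -(preimage_itvNyc f c); exact: mf.
have mdot u : measurable_fun [set: T] (fun t => dotv u (colv (W t))).
  exact: (measurableT_comp (measurable_dotv_colv u) (measurable_funP W)).
(* Each claim reduces to choosing a direction [u] for which the event lies in the half-space u.W >=
   |u|^2. *)
have tail_sub (S : set T) (u : 'cV[R]_k) (a : R) : measurable S ->
    norm2 u ^+ 2 = a -> (forall t, S t -> a <= dotv u (colv (W t))) ->
    (P S <= (expR (- (a / (2 * K ^+ 2 * nu1))))%R%:E)%E.
  move=> mS <- Su; apply: le_trans (tail u).
  by apply: le_measure; rewrite ?inE//; exact: mge.
have dot_delta (a : R) i (v : 'cV[R]_k) : dotv (a *: delta_mx i 0) v = a * v i 0.
  by rewrite dotvZl /dotv trmx_delta -rowE mxE.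
have norm_delta (a : R) i : norm2 (a *: delta_mx i 0 : 'cV[R]_k) ^+ 2 = a ^+ 2.
  by rewrite norm2_sqr dot_delta !mxE !eqxx mulr1 expr2.
split.
- apply: (@tail_sub _ w) => //.
    rewrite (_ : mkset _ = \bigcap_(i in [set: 'I_k]) [set t | w i 0 <= tnth (W t) i]).
      by apply: fin_bigcap_measurable => // i _; exact: mge.
    apply/seteqP; split=> t /=.
      by move=> h i _ /=; have := h i; rewrite mxE.
    by move=> h i; have := h i I; rewrite mxE.
  (* Since w_i >= 0, W_i >= w_i gives w_i W_i >= w_i^2; summing over i places the orthant in the
     half-space. *)
  move=> t wt; rewrite norm2_sqr !dotvE; apply: ler_sum => i _.
  by rewrite ler_wpM2l ?wt//; have := hw i; rewrite mxE.
- apply: (@tail_sub _ (- w)).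
  + rewrite (_ : mkset _ = \bigcap_(i in [set: 'I_k]) [set t | tnth (W t) i <= - w i 0]).
      by apply: fin_bigcap_measurable => // i _; exact: mle.
    apply/seteqP; split=> t /=.
      by move=> h i _ /=; have := h i; rewrite !mxE.
    by move=> h i; have := h i I; rewrite !mxE.
  + by rewrite !norm2_sqr dotvNr dotvC dotvNr opprK.
  + move=> t wt; rewrite norm2_sqr !dotvE; apply: ler_sum => i _.
    have := wt i; have := hw i; rewrite !mxE; nra.
- move=> i; have := hw i; rewrite mxE => wi0; split.
  (* The direction w_i e_i has squared norm w_i^2 and inner product w_i W_i with W. *)
  + apply: (@tail_sub _ (w i 0 *: delta_mx i 0)) => //; first exact: mge.
    by move=> t /= wt; rewrite dot_delta mxE expr2 ler_wpM2l.
  + apply: (@tail_sub _ (- w i 0 *: delta_mx i 0)); first exact: mle.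
      by rewrite norm_delta sqrrN.
    by move=> t /= wt; rewrite dot_delta mxE; nra.
Qed.
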